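(* Let $k$ be a field and $A=k[x_1,\ldots,x_d]$ the polynomial Hopf algebra. The Poisson Hopf structures on $A$ are exactly the Poisson algebra structures given by $$\{x_i,x_j\}=\sum_{l=1}^d\lambda_l^{ij}x_l\qquad(1\le i,j\le d),$$ where $\lambda_l^{ij}\in k$, $\lambda_l^{ij}=-\lambda_l^{ji}$, subject to the relations, for all $1\le i<j<m\le d$ and all $1\le s\le d$, $$\sum_{l=1}^d\left(\lambda_l^{ij}\lambda_s^{lm}+\lambda_l^{jm}\lambda_s^{li}+\lambda_l^{mi}\lambda_s^{lj}\right)=0.$$
   Context: $A=k[x_1,\ldots,x_d]$ is the Hopf algebra (universal enveloping algebra of the $d$-dimensional abelian Lie algebra) whose comultiplication $\Delta$ is the algebra map with $\Delta(x_i)=x_i\otimes1+1\otimes x_i$; Sweedler notation $\Delta(a)=\sum a_1\otimes a_2$. A Poisson algebra structure on $A$ is a Lie bracket $\{-,-\}$ on $A$ with $\{ab,c\}=a\{b,c\}+\{a,c\}b$ for all $a,b,c\in A$; it is determined by the values $\{x_i,x_j\}$ via $\{f,g\}=\sum_{i,j}\frac{\partial f}{\partial x_i}\frac{\partial g}{\partial x_j}\{x_i,x_j\}$. It is a Poisson Hopf structure if moreover $\Delta(\{a,b\})=\sum\{a_1,b_1\}\otimes a_2b_2+\sum a_1b_1\otimes\{a_2,b_2\}$ for all $a,b\in A$.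
   Formalization: That Poisson Hopf structures have this linear form is stated for k of characteristic 0 (in characteristic p, {x_1,x_2}=x_1^p is a counterexample); that every such λ gives a structure is stated for characteristic not 2 (there λ^{11}_1=1 satisfies the relations but gives no Lie bracket). *)

(* Defs.v *)
From mathcomp Require Import all_boot all_algebra.
From mathcomp.multinomials Require Import mpoly.

Set Implicit Arguments.
Unset Strict Implicit.
Unset Printing Implicit Defensive.

Import GRing.Theory.
Local Open Scope ring_scope.

(* The algebra A (x) A, for A = k[x_1, ..., x_d], is {mpoly k[d + d]}: the
   first d variables are the x_i (x) 1 and the last d are the 1 (x) x_i. *)

Definition tens (k : fieldType) (d : nat) (a b : {mpoly k[d]}) :
    {mpoly k[d + d]} :=
  comp_mpoly [tuple 'X_(lshift d i) | i < d] a *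
  comp_mpoly [tuple 'X_(rshift d i) | i < d] b.

Definition comul (k : fieldType) (d : nat) (a : {mpoly k[d]}) :
    {mpoly k[d + d]} :=
  comp_mpoly [tuple tens 'X_i 1 + tens 1 'X_i | i < d] a.

Record lie_bracket (k : fieldType) (V : lmodType k) (br : V -> V -> V) :
    Prop := LieBracket {
  lie_linearl : forall b, linear (fun a => br a b);
  lie_linearr : forall a, linear (br a);
  lie_alternating : forall a, br a a = 0;
  lie_jacobi : forall a b c,
    br a (br b c) + br b (br c a) + br c (br a b) = 0
}.

Record poisson (k : fieldType) (d : nat)
    (br : {mpoly k[d]} -> {mpoly k[d]} -> {mpoly k[d]}) : Prop := Poisson {
  poisson_lie : lie_bracket br;
  poisson_leibniz : forall a b c, br (a * b) c = a * br b c + br a c * b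
}.

(* The Sweedler sums are taken over arbitrary expressions of comul a and
   comul b as finite sums of pure tensors. *)
Definition comul_compatible (k : fieldType) (d : nat)
    (br : {mpoly k[d]} -> {mpoly k[d]} -> {mpoly k[d]}) : Prop :=
  forall (a b : {mpoly k[d]}) (sa sb : seq ({mpoly k[d]} * {mpoly k[d]})),
    comul a = \sum_(u <- sa) tens u.1 u.2 ->
    comul b = \sum_(v <- sb) tens v.1 v.2 ->
    comul (br a b) =
      \sum_(u <- sa) \sum_(v <- sb) tens (br u.1 v.1) (u.2 * v.2) +
      \sum_(u <- sa) \sum_(v <- sb) tens (u.1 * v.1) (br u.2 v.2).

Definition poisson_hopf (k : fieldType) (d : nat)
    (br : {mpoly k[d]} -> {mpoly k[d]} -> {mpoly k[d]}) : Prop :=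
  poisson br /\ comul_compatible br.

(* lam i j l stands for the scalar $\lambda_l^{ij}$. *)
Record structure_constants (k : fieldType) (d : nat)
    (lam : 'I_d -> 'I_d -> 'I_d -> k) : Prop := StructureConstants {
  sc_skew : forall i j l, lam i j l = - lam j i l;
  sc_jacobi : forall i j m s : 'I_d, (i < j < m)%N ->
    \sum_(l < d) (lam i j l * lam l m s + lam j m l * lam l i s +
                  lam m i l * lam l j s) = 0
}.

Definition linear_on_generators (k : fieldType) (d : nat)
    (lam : 'I_d -> 'I_d -> 'I_d -> k)
    (br : {mpoly k[d]} -> {mpoly k[d]} -> {mpoly k[d]}) : Prop :=
  forall i j : 'I_d, br 'X_i 'X_j = \sum_(l < d) lam i j l *: 'X_l.

(* Main.v *)
Require Import Defs.
From HB Require Import structures.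
From mathcomp Require Import all_boot all_algebra.
From mathcomp.multinomials Require Import mpoly.
From mathcomp Require Import ring.

Set Implicit Arguments.
Unset Strict Implicit.
Unset Printing Implicit Defensive.

Import GRing.Theory.
Local Open Scope ring_scope.

(** A polynomial bracket that is a derivation in each argument is determined
    by its values on the generators ([biderivation_ext]), and these values can
    be prescribed at will ([biderivation_of]).  Everything below is a
    consequence of this rigidity, used in the more flexible form of two
    derivations along an algebra morphism that agree on the generators
    ([derivation_along_ext]).

    - From Hopf to linear.  Compatibility with the comultiplication, read on
      two generators, says that [p = br 'X_i 'X_j] is primitive.  Multiplying
      the two tensor factors of [comul p = p (x) 1 + 1 (x) p] gives
      [p(2 x) = 2 p(x)], so that in characteristic zero only the coefficients
      of degree one survive ([primitive_linear]).  Skew-symmetry and the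
      Jacobi identity on the generators are then the relations between the
      structure constants ([structure_constants_of_poisson]).

    - From linear to Hopf.  The tensor square carries the biderivation
      restricting to [br] on each factor and vanishing across the factors
      ([tens_bracket]).  Its value on pure tensors is the right-hand side of
      the compatibility condition, and [comul] maps [br] to it because it does
      so on the generators, where linearity of [br 'X_i 'X_j] is used
      ([tens_bracket_comul]).

    - Existence.  The biderivation with the prescribed linear values is
      alternating when 2 is invertible.  Its Jacobiator is alternating
      and a derivation in each argument, hence vanishes as soon as it vanishes
      on increasing triples of generators ([biderivation_jacobi]), which is
      the quadratic relation ([jacobi_on_generators]). *)

(** * Derivations on polynomial algebras *)

Lemma linear_fun_sum (k : fieldType) (U V : lmodType k) (f : U -> V)
    (I : Type) (r : seq I) (F : I -> U) :
  linear f -> f (\sum_(i <- r) F i) = \sum_(i <- r) f (F i).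
Proof.
move=> lf; apply: big_morph => [x y|].
  by have := lf 1 x y; rewrite !scale1r.
by have := lf (-1) 0 0; rewrite scaler0 addr0 scaleN1r addNr.
Qed.

(** Induction on [{mpoly k[n]}] as the algebra generated by the variables. *)
Lemma mpoly_algebra_ind (k : fieldType) (n : nat)
    (P : {mpoly k[n]} -> Prop) :
    P 1 -> (forall a b, P a -> P b -> P (a * b)) ->
    (forall c a b, P a -> P b -> P (c *: a + b)) ->
    (forall i, P 'X_i) ->
  forall p, P p.
Proof.
move=> P1 PM PL PX p.
elim/mpolyind: p => [|c m p _ _ Pp].
  by have := PL (-1) 1 1 P1 P1; rewrite scaleN1r addNr.
apply: PL => //; rewrite mpolyXE_id; apply: big_ind => // i _.
by elim: (m i) => [|e IHe]; rewrite ?expr0 // exprS; apply: PM.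
Qed.

(** Derivations of [{mpoly k[n]}] into [{mpoly k[m]}], the latter being a
    module over the former through [phi]. *)
Record derivation_along (k : fieldType) (n m : nat)
    (phi D : {mpoly k[n]} -> {mpoly k[m]}) : Prop := DerivationAlong {
  derivation_linear : linear D;
  derivation_leibniz : forall a b, D (a * b) = phi a * D b + D a * phi b
}.

Lemma derivation_along_ext (k : fieldType) (n m : nat)
    (phi : {lrmorphism {mpoly k[n]} -> {mpoly k[m]}})
    (D1 D2 : {mpoly k[n]} -> {mpoly k[m]}) :
    derivation_along phi D1 -> derivation_along phi D2 ->
    (forall i, D1 'X_i = D2 'X_i) ->
  D1 =1 D2.
Proof.
move=> [l1 d1] [l2 d2] eqX.
(* From [D 1 = D (1 * 1) = D 1 + D 1]. *)
have D_1 (D : {mpoly k[n]} -> {mpoly k[m]}) :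
    (forall a b, D (a * b) = phi a * D b + D a * phi b) -> D 1 = 0.
  move=> dD; have := dD 1 1; rewrite mulr1 rmorph1 mul1r mulr1.
  by move/(congr1 (fun x => x - D 1)); rewrite subrr addrK => <-.
apply: mpoly_algebra_ind => [|a b Ha Hb|c a b Ha Hb|//].
- by rewrite !D_1.
- by rewrite d1 d2 Ha Hb.
- by rewrite l1 l2 Ha Hb.
Qed.

Lemma derivation_along0 (k : fieldType) (n m : nat)
    (phi : {mpoly k[n]} -> {mpoly k[m]}) :
  derivation_along phi (fun=> 0).
Proof.
by split=> [c u v|a b]; rewrite ?scaler0 ?mulr0 ?mul0r addr0.
Qed.

(** * Biderivations *)

(** Maps that are derivations of [{mpoly k[n]}] in each argument separately. *)
Record biderivation (k : fieldType) (n : nat)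
    (b : {mpoly k[n]} -> {mpoly k[n]} -> {mpoly k[n]}) : Prop :=
  Biderivation {
  biderivation_l : forall g, derivation_along id (b^~ g);
  biderivation_r : forall f, derivation_along id (b f)
}.

Section Biderivation.
Variables (k : fieldType) (n : nat).
Variable b : {mpoly k[n]} -> {mpoly k[n]} -> {mpoly k[n]}.
Hypothesis bP : biderivation b.

Lemma biderivation_comp_l (m : nat)
    (phi : {lrmorphism {mpoly k[m]} -> {mpoly k[n]}}) (g : {mpoly k[n]}) :
  derivation_along phi (fun f => b (phi f) g).
Proof.
have [lb db] := biderivation_l bP g; split=> [c u v|u v] /=.
  by rewrite linearP lb.
by rewrite rmorphM db.
Qed.

Lemma biderivation_comp_r (m : nat)
    (phi : {lrmorphism {mpoly k[m]} -> {mpoly k[n]}}) (f : {mpoly k[n]}) :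
  derivation_along phi (fun g => b f (phi g)).
Proof.
have [lb db] := biderivation_r bP f; split=> [c u v|u v] /=.
  by rewrite linearP lb.
by rewrite rmorphM db.
Qed.

Lemma biderivation_morph_l (m : nat)
    (phi : {lrmorphism {mpoly k[n]} -> {mpoly k[m]}}) (g : {mpoly k[n]}) :
  derivation_along phi (fun f => phi (b f g)).
Proof.
have [lb db] := biderivation_l bP g; split=> [c u v|u v] /=.
  by rewrite lb linearP.
by rewrite db rmorphD !rmorphM.
Qed.

Lemma biderivation_morph_r (m : nat)
    (phi : {lrmorphism {mpoly k[n]} -> {mpoly k[m]}}) (f : {mpoly k[n]}) :
  derivation_along phi (fun g => phi (b f g)).
Proof.
have [lb db] := biderivation_r bP f; split=> [c u v|u v] /=.
  by rewrite lb linearP.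
by rewrite db rmorphD !rmorphM.
Qed.

Lemma biderivation_suml (I : Type) (r : seq I) F g :
  b (\sum_(i <- r) F i) g = \sum_(i <- r) b (F i) g.
Proof. exact: linear_fun_sum (derivation_linear (biderivation_l bP g)). Qed.

Lemma biderivation_sumr (I : Type) (r : seq I) F f :
  b f (\sum_(i <- r) F i) = \sum_(i <- r) b f (F i).
Proof. exact: linear_fun_sum (derivation_linear (biderivation_r bP f)). Qed.

Lemma biderivation_Ml u v g : b (u * v) g = u * b v g + b u g * v.
Proof. exact: derivation_leibniz (biderivation_l bP g) u v. Qed.

Lemma biderivation_Mr f u v : b f (u * v) = u * b f v + b f u * v.
Proof. exact: derivation_leibniz (biderivation_r bP f) u v. Qed.

Lemma biderivation_Pl c u v g : b (c *: u + v) g = c *: b u g + b v g.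
Proof. exact: derivation_linear (biderivation_l bP g) c u v. Qed.

Lemma biderivation_Pr f c u v : b f (c *: u + v) = c *: b f u + b f v.
Proof. exact: derivation_linear (biderivation_r bP f) c u v. Qed.

Lemma biderivation_Dl u v g : b (u + v) g = b u g + b v g.
Proof. by have := biderivation_Pl 1 u v g; rewrite !scale1r. Qed.

Lemma biderivation_Dr f u v : b f (u + v) = b f u + b f v.
Proof. by have := biderivation_Pr f 1 u v; rewrite !scale1r. Qed.

Lemma biderivation_0r f : b f 0 = 0.
Proof. by have := biderivation_sumr [::] id f; rewrite !big_nil. Qed.

Lemma biderivation_Nr f u : b f (- u) = - b f u.
Proof.
by have := biderivation_Pr f (-1) u 0;
  rewrite biderivation_0r !addr0 !scaleN1r.
Qed.

Lemma biderivation_sum_Zr (I : Type) (r : seq I) (c : I -> k) F f :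
  b f (\sum_(i <- r) c i *: F i) = \sum_(i <- r) c i *: b f (F i).
Proof.
rewrite biderivation_sumr; apply: eq_bigr => i _.
by have := biderivation_Pr f (c i) (F i) 0; rewrite biderivation_0r !addr0.
Qed.

Lemma biderivation_1r f : b f 1 = 0.
Proof.
have := biderivation_Mr f 1 1; rewrite !mulr1 mul1r.
by move/(congr1 (fun x => x - b f 1)); rewrite subrr addrK => <-.
Qed.

Lemma biderivation_1l g : b 1 g = 0.
Proof.
have := biderivation_Ml 1 1 g; rewrite !mulr1 mul1r.
by move/(congr1 (fun x => x - b 1 g)); rewrite subrr addrK => <-.
Qed.

End Biderivation.

(** An algebra morphism respects two biderivations as soon as it does so on
    the generators. *)
Lemma biderivation_morph_ext (k : fieldType) (n m : nat)
    (phi : {lrmorphism {mpoly k[n]} -> {mpoly k[m]}})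
    (b : {mpoly k[n]} -> {mpoly k[n]} -> {mpoly k[n]})
    (b' : {mpoly k[m]} -> {mpoly k[m]} -> {mpoly k[m]}) :
    biderivation b -> biderivation b' ->
    (forall i j, b' (phi 'X_i) (phi 'X_j) = phi (b 'X_i 'X_j)) ->
  forall f g, b' (phi f) (phi g) = phi (b f g).
Proof.
move=> bP b'P eqX f g; move: f.
apply: (derivation_along_ext (phi := phi)) => [||i].
- exact: biderivation_comp_l.
- exact: biderivation_morph_l.
move: g; apply: (derivation_along_ext (phi := phi)) => [||j].
- exact: biderivation_comp_r.
- exact: biderivation_morph_r.
exact: eqX.
Qed.

Lemma biderivation_ext (k : fieldType) (n : nat)
    (b b' : {mpoly k[n]} -> {mpoly k[n]} -> {mpoly k[n]}) :
    biderivation b -> biderivation b' ->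
    (forall i j, b 'X_i 'X_j = b' 'X_i 'X_j) ->
  b =2 b'.
Proof.
by move=> bP b'P eqX; exact: (biderivation_morph_ext (phi := idfun) b'P bP).
Qed.

Lemma biderivation_orth (k : fieldType) (n n' m : nat)
    (phi : {lrmorphism {mpoly k[n]} -> {mpoly k[m]}})
    (psi : {lrmorphism {mpoly k[n']} -> {mpoly k[m]}})
    (b : {mpoly k[m]} -> {mpoly k[m]} -> {mpoly k[m]}) :
    biderivation b ->
    (forall i j, b (phi 'X_i) (psi 'X_j) = 0) ->
  forall f g, b (phi f) (psi g) = 0.
Proof.
move=> bP eqX f g; move: f.
apply: (derivation_along_ext (phi := phi)) => [||i].
- exact: biderivation_comp_l.
- exact: derivation_along0.
move: g; apply: (derivation_along_ext (phi := psi)) => [||j].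
- exact: biderivation_comp_r.
- exact: derivation_along0.
exact: eqX.
Qed.

(** The biderivation with prescribed values [W i j] on the generators. *)
Definition biderivation_of (k : fieldType) (n : nat)
    (W : 'I_n -> 'I_n -> {mpoly k[n]}) (f g : {mpoly k[n]}) : {mpoly k[n]} :=
  \sum_(i < n) \sum_(j < n) f^`M(i) * g^`M(j) * W i j.

Lemma biderivation_ofP (k : fieldType) (n : nat)
    (W : 'I_n -> 'I_n -> {mpoly k[n]}) :
  biderivation (biderivation_of W).
Proof.
rewrite /biderivation_of.
split=> f; split=> [c u v|u v] /=; rewrite ?scaler_sumr ?mulr_sumr ?mulr_suml;
  rewrite -big_split; apply: eq_bigr => i _ /=;
  rewrite ?scaler_sumr ?mulr_sumr ?mulr_suml;
  rewrite -big_split; apply: eq_bigr => j _ /=.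
- by rewrite linearP /= !mulrDl -!scalerAl.
- by rewrite mderivM; ring.
- by rewrite linearP /= mulrDr mulrDl -scalerAr -scalerAl.
- by rewrite mderivM; ring.
Qed.

Lemma biderivation_ofX (k : fieldType) (n : nat)
    (W : 'I_n -> 'I_n -> {mpoly k[n]}) (i j : 'I_n) :
  biderivation_of W 'X_i 'X_j = W i j.
Proof.
have dX (u v : 'I_n) : ('X_u : {mpoly k[n]})^`M(v) = (u == v)%:R.
  rewrite mderivX mnm1E; case: eqVneq => [->|_]; last by rewrite scale0r.
  by rewrite scale1r -{1}[U_(v)%MM]add0m addmK mpolyX0.
rewrite /biderivation_of (bigD1 i) //= (bigD1 j) //= !dX !eqxx !mul1r.
rewrite !big1 ?addr0 // => u neq.
  by rewrite big1 // => v _; rewrite dX eq_sym (negPf neq) !mul0r.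
by rewrite dX [j == u]eq_sym (negPf neq) mulr0 mul0r.
Qed.

(** * Poisson brackets *)

Lemma lie_bracket_skew (k : fieldType) (V : lmodType k) (br : V -> V -> V) :
  lie_bracket br -> forall a b, br a b = - br b a.
Proof.
case=> ll lr alt _ a b; apply/eqP; rewrite -addr_eq0; apply/eqP.
have Dl u v w : br (u + v) w = br u w + br v w.
  by have := ll w 1 u v; rewrite !scale1r.
have Dr u v w : br w (u + v) = br w u + br w v.
  by have := lr w 1 u v; rewrite !scale1r.
by have := alt (a + b); rewrite Dl !Dr !alt add0r addr0.
Qed.

Lemma poisson_biderivation (k : fieldType) (d : nat)
    (br : {mpoly k[d]} -> {mpoly k[d]} -> {mpoly k[d]}) :
  poisson br -> biderivation br.
Proof.
move=> [lieP leib]; have skew := lie_bracket_skew lieP.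
split=> f; split.
- exact: lie_linearl lieP f.
- by move=> u v; rewrite leib.
- exact: lie_linearr lieP f.
- by move=> u v; rewrite skew leib (skew u) (skew v) /=; ring.
Qed.

Section Jacobi.
Variables (k : fieldType) (d : nat).
Variable br : {mpoly k[d]} -> {mpoly k[d]} -> {mpoly k[d]}.
Hypothesis brP : biderivation br.
Hypothesis br_alt : forall a, br a a = 0.

(** The Jacobiator of [br]. *)
Let jac a b c := br a (br b c) + br b (br c a) + br c (br a b).

Lemma biderivation_skew a b : br a b = - br b a.
Proof.
apply/eqP; rewrite -addr_eq0; apply/eqP.
have := br_alt (a + b).
by rewrite (biderivation_Dl brP) !(biderivation_Dr brP) !br_alt add0r addr0.
Qed.

Lemma jacobiator_cyc a b c : jac a b c = jac b c a.
Proof. by rewrite /jac -addrA addrC. Qed.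

Lemma jacobiator_swap a b c : jac b a c = - jac a b c.
Proof.
rewrite /jac (biderivation_skew a c) (biderivation_skew b a).
rewrite (biderivation_skew c b) !(biderivation_Nr brP); ring.
Qed.

Lemma jacobiator_alt a c : jac a a c = 0.
Proof.
rewrite /jac (biderivation_skew c a) !(biderivation_Nr brP) br_alt.
by rewrite (biderivation_0r brP) addr0 subrr.
Qed.

(** The Jacobiator is the commutator of the derivations [br a] and [br b],
    minus the derivation [br (br a b)]. *)
Lemma jacobiator_derivation a b : derivation_along id (jac a b).
Proof.
have jacE c : jac a b c = br a (br b c) - br b (br a c) - br (br a b) c.
  by rewrite /jac (biderivation_skew c a) (biderivation_skew c)
             !(biderivation_Nr brP).
split=> [c u v|u v]; rewrite !jacE.
  rewrite !(biderivation_Pr brP) !scalerBr !opprD.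
  set x1 := c *: _; set x2 := br a _; set x3 := c *: _; set x4 := br b _.
  set x5 := c *: _; set x6 := br _ v; ring.
do !rewrite (biderivation_Mr brP, biderivation_Dr brP); ring.
Qed.

Lemma biderivation_jacobi :
    (forall i j m : 'I_d, (i < j < m)%N -> jac 'X_i 'X_j 'X_m = 0) ->
  forall a b c, jac a b c = 0.
Proof.
move=> jac_lt.
have jac_eq (i j : 'I_d) c : i = j -> jac 'X_i 'X_j c = 0.
  by move=> ->; apply: jacobiator_alt.
have swap0 a b c : jac b a c = 0 -> jac a b c = 0.
  by rewrite (jacobiator_swap b a) => ->; rewrite oppr0.
(* First an arbitrary third index, then an arbitrary order of the first two,
   using cyclic invariance and antisymmetry. *)
have jac_lt2 (i j m : 'I_d) : (i < j)%N -> jac 'X_i 'X_j 'X_m = 0.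
  move=> ltij; case: (ltngtP j m) => [ltjm|ltmj|/val_inj eqjm].
  - by apply: jac_lt; rewrite ltij.
  - case: (ltngtP i m) => [ltim|ltmi|/val_inj eqim].
    + rewrite jacobiator_cyc jacobiator_cyc; apply: swap0.
      by apply: jac_lt; rewrite ltim.
    + by rewrite jacobiator_cyc jacobiator_cyc; apply: jac_lt; rewrite ltmi.
    + by rewrite jacobiator_cyc jacobiator_cyc; apply: jac_eq.
  - by rewrite jacobiator_cyc; apply: jac_eq.
have jacX (i j m : 'I_d) : jac 'X_i 'X_j 'X_m = 0.
  case: (ltngtP i j) => [|ltji|/val_inj]; [exact: jac_lt2| |exact: jac_eq].
  by apply: swap0; apply: jac_lt2.
(* Each argument is freed in turn, after cycling it to the last place. *)
have ext a b : (forall i, jac a b 'X_i = 0) -> forall c, jac a b c = 0.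
  by apply: (derivation_along_ext (phi := idfun));
    [exact: jacobiator_derivation | exact: derivation_along0].
have jac3 (i j : 'I_d) c : jac 'X_i 'X_j c = 0 by apply: ext.
have jac2 (i : 'I_d) b c : jac b c 'X_i = 0.
  rewrite -jacobiator_cyc; apply: (ext) => j.
  by rewrite -jacobiator_cyc.
by move=> a b; apply: ext.
Qed.

End Jacobi.

(** The sign comes from [br 'X_u 'X_l = - br 'X_l 'X_u]: the quadratic
    relation has the brackets nested on the left. *)
Lemma jacobi_on_generators (k : fieldType) (d : nat)
    (br : {mpoly k[d]} -> {mpoly k[d]} -> {mpoly k[d]})
    (lam : 'I_d -> 'I_d -> 'I_d -> k) (i j m : 'I_d) :
    biderivation br -> linear_on_generators lam br ->
    (forall i j l, lam i j l = - lam j i l) ->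
  br 'X_i (br 'X_j 'X_m) + br 'X_j (br 'X_m 'X_i) + br 'X_m (br 'X_i 'X_j) =
  - \sum_(s < d) (\sum_(l < d) (lam i j l * lam l m s + lam j m l * lam l i s +
                                lam m i l * lam l j s)) *: 'X_s.
Proof.
move=> brP lin skew.
have brbr u v w : br 'X_u (br 'X_v 'X_w) =
    - \sum_(s < d) (\sum_(l < d) lam v w l * lam l u s) *: 'X_s.
  rewrite lin (biderivation_sum_Zr brP) -sumrN.
  under eq_bigr => l _ do rewrite lin scaler_sumr.
  rewrite exchange_big; apply: eq_bigr => s _ /=.
  rewrite scaler_suml -sumrN; apply: eq_bigr => l _.
  by rewrite scalerA (skew u l) mulrN scaleNr.
rewrite !brbr -!opprD -!big_split; congr (- _); apply: eq_bigr => s _ /=.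
rewrite -!scalerDl -!big_split; congr (_ *: _); apply: eq_bigr => l _ /=.
by rewrite addrC addrA.
Qed.

(** * The comultiplication *)

Lemma comp_mpoly_mktupleX (k : fieldType) (n m : nat)
    (F : 'I_n -> {mpoly k[m]}) (i : 'I_n) :
  'X_i \mPo [tuple F j | j < n] = F i.
Proof. by rewrite comp_mpolyXU (nth_map i) ?size_enum_ord // nth_ord_enum. Qed.

Section Comultiplication.
Variables (k : fieldType) (d : nat).

(** The coordinate embeddings [a |-> a (x) 1] and [b |-> 1 (x) b]. *)
Definition tensl (a : {mpoly k[d]}) : {mpoly k[d + d]} :=
  a \mPo [tuple 'X_(lshift d i) | i < d].
HB.instance Definition _ := GRing.LRMorphism.copy tensl
  (comp_mpoly [tuple 'X_(lshift d i) | i < d]).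

Definition tensr (a : {mpoly k[d]}) : {mpoly k[d + d]} :=
  a \mPo [tuple 'X_(rshift d i) | i < d].
HB.instance Definition _ := GRing.LRMorphism.copy tensr
  (comp_mpoly [tuple 'X_(rshift d i) | i < d]).

HB.instance Definition _ := GRing.LRMorphism.copy (@comul k d)
  (comp_mpoly [tuple tens 'X_i 1 + tens 1 'X_i | i < d]).

Lemma tenslX i : tensl 'X_i = 'X_(lshift d i).
Proof. exact: comp_mpoly_mktupleX. Qed.

Lemma tensrX i : tensr 'X_i = 'X_(rshift d i).
Proof. exact: comp_mpoly_mktupleX. Qed.

Lemma tensE a b : tens a b = tensl a * tensr b.
Proof. by []. Qed.

Lemma tens0l b : tens 0 b = 0 :> {mpoly k[d + d]}.
Proof. by rewrite tensE linear0 mul0r. Qed.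

Lemma tens0r a : tens a 0 = 0 :> {mpoly k[d + d]}.
Proof. by rewrite tensE linear0 mulr0. Qed.

Lemma comulX i : comul ('X_i : {mpoly k[d]}) = tens 'X_i 1 + tens 1 'X_i.
Proof. exact: comp_mpoly_mktupleX. Qed.

Lemma split_lshift (m n : nat) (i : 'I_m) : split (lshift n i) = inl i.
Proof. exact: (unsplitK (inl i)). Qed.

Lemma split_rshift (m n : nat) (i : 'I_n) : split (rshift m i) = inr i.
Proof. exact: (unsplitK (inr i)). Qed.

(** The multiplication map [a (x) b |-> a * b]. *)
Definition tens_mul (a : {mpoly k[d + d]}) : {mpoly k[d]} :=
  a \mPo [tuple match split i with inl j => 'X_j | inr j => 'X_j end
         | i < d + d].
HB.instance Definition _ := GRing.LRMorphism.copy tens_mul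
  (comp_mpoly [tuple match split i with inl j => 'X_j | inr j => 'X_j end
              | i < d + d]).

Lemma tens_mul_l a : tens_mul (tensl a) = a.
Proof.
move: a; apply: mpoly_algebra_ind => [|a b Ha Hb|c a b Ha Hb|i].
- by rewrite !rmorph1.
- by rewrite !rmorphM /= Ha Hb.
- by rewrite !linearP /= Ha Hb.
by rewrite tenslX [LHS]comp_mpoly_mktupleX split_lshift.
Qed.

Lemma tens_mul_r a : tens_mul (tensr a) = a.
Proof.
move: a; apply: mpoly_algebra_ind => [|a b Ha Hb|c a b Ha Hb|i].
- by rewrite !rmorph1.
- by rewrite !rmorphM /= Ha Hb.
- by rewrite !linearP /= Ha Hb.
by rewrite tensrX [LHS]comp_mpoly_mktupleX split_rshift.
Qed.

Lemma tens_mul_tens a b : tens_mul (tens a b) = a * b.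
Proof. by rewrite tensE rmorphM /= tens_mul_l tens_mul_r. Qed.

(** Multiplication after comultiplication is the dilation [x_i |-> 2 x_i]. *)
Lemma tens_mul_comul_coeff (p : {mpoly k[d]}) (m : 'X_{1..d}) :
  (tens_mul (comul p))@_m = 2%:R ^+ mdeg m * p@_m.
Proof.
elim/mpolyind: p => [|c m' p _ _ IHp]; first by rewrite !linear0 mulr0.
rewrite !linearP /= IHp mulrDr; congr (_ + _).
suff -> : tens_mul (comul 'X_[m']) = 2%:R ^+ mdeg m' *: 'X_[m'].
  rewrite mcoeffZ mcoeffX; case: eqVneq => [->|_]; last by rewrite !mulr0.
  by rewrite !mulr1 mulrC.
rewrite [X in _ = _ *: X]mpolyXE_id mdegE -prodrXr -scaler_prod.
rewrite mpolyXE_id !rmorph_prod; apply: eq_bigr => i _ /=.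
rewrite !rmorphXn /= comulX rmorphD /= !tens_mul_tens.
by rewrite mulr1 mul1r -mulr2n -exprZn scaler_nat.
Qed.

(** Primitive elements are linear forms in characteristic zero: applying the
    multiplication to [comul p] gives [p(2 x) = 2 p(x)], so that the
    coefficient of a monomial of degree [e] is killed by [2 ^ e - 2]. *)
Lemma primitive_linear (p : {mpoly k[d]}) :
    [pchar k] =i pred0 -> comul p = tens p 1 + tens 1 p ->
  p = \sum_(l < d) p@_U_(l) *: 'X_l.
Proof.
move=> /pcharf0P k0 prim.
have p0 m : mdeg m != 1%N -> p@_m = 0.
  move=> m1; have := tens_mul_comul_coeff p m.
  rewrite prim rmorphD /= !tens_mul_tens mulr1 mul1r -mulr2n mcoeffMn.
  rewrite -[p@_m *+ 2]mulr_natl => /eqP; rewrite -subr_eq0 -mulrBl mulf_eq0.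
  case/orP=> [|/eqP //]; rewrite -natrX.
  case: (mdeg m) m1 => [|[|e]] // _.
    by rewrite expn0 -natrB // k0.
  rewrite -opprB oppr_eq0 -natrB; last by rewrite (leq_exp2l 1).
  by rewrite k0 subn_eq0 leqNgt (ltn_exp2l 1).
apply/mpolyP => m; rewrite linear_sum /=.
have [/mdeg1P[i /eqP ->]|m1] := boolP (mdeg m == 1%N).
  rewrite (bigD1 i) //= mcoeffZ mcoeffX eqxx mulr1 big1 ?addr0 // => j ji.
  by rewrite mcoeffZ mcoeffXU (negPf ji) mulr0.
rewrite (p0 _ m1) big1 // => i _; rewrite mcoeffZ mcoeffX.
by case: eqVneq => [eqm|_]; [rewrite -eqm mdeg1 in m1 | rewrite mulr0].
Qed.

(** The Poisson bracket of the tensor square, determined by its values on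
    the generators: that of [br] on each factor, and [0] across. *)
Definition tens_bracket (br : {mpoly k[d]} -> {mpoly k[d]} -> {mpoly k[d]}) :
    {mpoly k[d + d]} -> {mpoly k[d + d]} -> {mpoly k[d + d]} :=
  biderivation_of (fun u v =>
    match split u, split v with
    | inl i, inl j => tensl (br 'X_i 'X_j)
    | inr i, inr j => tensr (br 'X_i 'X_j)
    | _, _ => 0
    end).

Section TensBracket.
Variable br : {mpoly k[d]} -> {mpoly k[d]} -> {mpoly k[d]}.
Hypothesis brP : biderivation br.

Let TP : biderivation (tens_bracket br) := biderivation_ofP _.

Lemma tens_bracket_ll a c :
  tens_bracket br (tensl a) (tensl c) = tensl (br a c).
Proof.
apply: biderivation_morph_ext => // i j /=.
by rewrite !tenslX /tens_bracket biderivation_ofX !split_lshift.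
Qed.

Lemma tens_bracket_rr a c :
  tens_bracket br (tensr a) (tensr c) = tensr (br a c).
Proof.
apply: biderivation_morph_ext => // i j /=.
by rewrite !tensrX /tens_bracket biderivation_ofX !split_rshift.
Qed.

Lemma tens_bracket_lr a c : tens_bracket br (tensl a) (tensr c) = 0.
Proof.
apply: biderivation_orth => // i j /=.
by rewrite tenslX tensrX /tens_bracket biderivation_ofX split_lshift
           split_rshift.
Qed.

Lemma tens_bracket_rl a c : tens_bracket br (tensr a) (tensl c) = 0.
Proof.
apply: biderivation_orth => // i j /=.
by rewrite tenslX tensrX /tens_bracket biderivation_ofX split_lshift
           split_rshift.
Qed.

Lemma tens_bracket_tens a b c e :
  tens_bracket br (tens a b) (tens c e) =
  tens (br a c) (b * e) + tens (a * c) (br b e).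
Proof.
rewrite !tensE (biderivation_Ml TP) !(biderivation_Mr TP).
rewrite tens_bracket_ll tens_bracket_rr tens_bracket_lr tens_bracket_rl.
rewrite !rmorphM /=.
move: (tensl a) (tensl c) (tensl (br a c)) => a1 c1 ac1.
by move: (tensr b) (tensr e) (tensr (br b e)) => b2 e2 be2; ring.
Qed.

(** On the generators, [comul 'X_i] is [x_i (x) 1 + 1 (x) x_i], so the
    left-hand side is [p (x) 1 + 1 (x) p] with [p = br 'X_i 'X_j]; this is
    [comul p] because [p] is a linear form. *)
Lemma tens_bracket_comul lam :
    linear_on_generators lam br ->
  forall a b, tens_bracket br (comul a) (comul b) = comul (br a b).
Proof.
move=> lin.
apply: (biderivation_morph_ext (phi := @comul k d)) => // i j /=.
rewrite !comulX (biderivation_Dl TP) !(biderivation_Dr TP).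
rewrite !tens_bracket_tens !(biderivation_1l brP) !(biderivation_1r brP).
rewrite !mulr1 !mul1r !tens0l !tens0r.
rewrite !addr0 !add0r !tensE !rmorph1 mulr1 mul1r lin !linear_sum -big_split.
apply: eq_bigr => l _ /=.
rewrite !linearZ -scalerDr; congr (_ *: _).
by rewrite /= comulX !tensE !rmorph1 mulr1 mul1r.
Qed.

Lemma linear_comul_compatible lam :
  linear_on_generators lam br -> comul_compatible br.
Proof.
move=> lin a b sa sb ea eb; rewrite -(tens_bracket_comul lin) ea eb.
rewrite (biderivation_suml TP) -big_split; apply: eq_bigr => u _ /=.
rewrite (biderivation_sumr TP) -big_split; apply: eq_bigr => v _ /=.
exact: tens_bracket_tens.
Qed.

End TensBracket.

Let sum_pair (T : Type) (x y : T) (F : T -> {mpoly k[d + d]}) :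
  \sum_(u <- [:: x; y]) F u = F x + F y.
Proof. by rewrite big_cons big_seq1. Qed.

Lemma hopf_bracket_primitive
    (br : {mpoly k[d]} -> {mpoly k[d]} -> {mpoly k[d]}) (i j : 'I_d) :
    biderivation br -> comul_compatible br ->
  comul (br 'X_i 'X_j) = tens (br 'X_i 'X_j) 1 + tens 1 (br 'X_i 'X_j).
Proof.
move=> brP comp.
have sX (l : 'I_d) : comul ('X_l : {mpoly k[d]}) =
    \sum_(u <- [:: ('X_l : {mpoly k[d]}, 1); (1, 'X_l)]) tens u.1 u.2.
  by rewrite comulX sum_pair.
have := comp _ _ _ _ (sX i) (sX j); rewrite !sum_pair => ->.
rewrite !(biderivation_1l brP) !(biderivation_1r brP) /= !tens0l !tens0r.
by rewrite !addr0 !add0r mulr1.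
Qed.

End Comultiplication.

Lemma structure_constants_of_poisson (k : fieldType) (d : nat)
    (br : {mpoly k[d]} -> {mpoly k[d]} -> {mpoly k[d]})
    (lam : 'I_d -> 'I_d -> 'I_d -> k) :
  poisson br -> linear_on_generators lam br -> structure_constants lam.
Proof.
move=> brP lin; have bP := poisson_biderivation brP.
have coefE (c : 'I_d -> k) (s : 'I_d) :
    (\sum_(l < d) c l *: 'X_l : {mpoly k[d]})@_U_(s) = c s.
  rewrite linear_sum /= (bigD1 s) //= mcoeffZ mcoeffX eqxx mulr1.
  rewrite big1 ?addr0 // => l ls.
  by rewrite mcoeffZ mcoeffXU (negPf ls) mulr0.
have skew i j l : lam i j l = - lam j i l.
  have := lie_bracket_skew (poisson_lie brP) 'X_i 'X_j.
  by move/(congr1 (mcoeff U_(l))); rewrite mcoeffN !lin !coefE.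
split=> // i j m s _.
have := lie_jacobi (poisson_lie brP) 'X_i 'X_j 'X_m.
rewrite (jacobi_on_generators _ _ _ bP lin skew) => /eqP; rewrite oppr_eq0.
by move/eqP/(congr1 (mcoeff U_(s))); rewrite coefE mcoeff0.
Qed.

(** The hypothesis on the characteristic is needed because structure constants
    are only skew, while a Lie bracket is alternating. *)
Lemma poisson_of_structure_constants (k : fieldType) (d : nat)
    (lam : 'I_d -> 'I_d -> 'I_d -> k) :
    2%N \notin [pchar k] -> structure_constants lam ->
  poisson (biderivation_of (fun i j => \sum_(l < d) lam i j l *: 'X_l)).
Proof.
move=> k2 [skew jac]; set br := biderivation_of _.
have bP : biderivation br := biderivation_ofP _.
have lin : linear_on_generators lam br by move=> i j; exact: biderivation_ofX.
have alt a : br a a = 0.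
  have brN : br a a = - br a a.
    rewrite {1}/br /biderivation_of exchange_big -sumrN.
    apply: eq_bigr => i _ /=; rewrite -sumrN; apply: eq_bigr => j _ /=.
    rewrite [a^`M(j) * _]mulrC -mulrN -sumrN; congr (_ * _).
    by apply: eq_bigr => l _; rewrite skew scaleNr.
  have /eqP : 2%:R *: br a a = 0.
    by rewrite scaler_nat mulr2n {2}brN subrr.
  rewrite scaler_eq0 => /orP[k2'|/eqP //].
  by case/negP: k2; rewrite inE /=.
split; last exact: biderivation_Ml.
split=> // [b|a|].
- exact: derivation_linear (biderivation_l bP b).
- exact: derivation_linear (biderivation_r bP a).
apply: biderivation_jacobi => // i j m ltijm.
rewrite (jacobi_on_generators _ _ _ bP lin skew) big1 ?oppr0 // => s _.
by rewrite jac // scale0r.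
Qed.

Theorem proposition5p3 (k : fieldType) (d : nat) :
  [/\ [pchar k] =i pred0 ->
      forall br : {mpoly k[d]} -> {mpoly k[d]} -> {mpoly k[d]},
        poisson_hopf br ->
        poisson br /\
        exists2 lam : 'I_d -> 'I_d -> 'I_d -> k,
          structure_constants lam & linear_on_generators lam br,
      forall (br : {mpoly k[d]} -> {mpoly k[d]} -> {mpoly k[d]})
             (lam : 'I_d -> 'I_d -> 'I_d -> k),
        poisson br -> structure_constants lam ->
        linear_on_generators lam br -> poisson_hopf br
    & 2%N \notin [pchar k] ->
      forall lam : 'I_d -> 'I_d -> 'I_d -> k,
        structure_constants lam ->
        exists br : {mpoly k[d]} -> {mpoly k[d]} -> {mpoly k[d]},
          [/\ poisson br, linear_on_generators lam br &
              forall br' : {mpoly k[d]} -> {mpoly k[d]} -> {mpoly k[d]},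
                poisson br' -> linear_on_generators lam br' -> br' =2 br] ].
Proof.
split.
- move=> k0 br [brP comp]; split=> //.
  have lin : linear_on_generators (fun i j l => (br 'X_i 'X_j)@_U_(l)) br.
    move=> i j; apply: primitive_linear => //.
    exact: hopf_bracket_primitive (poisson_biderivation brP) comp.
  by eexists; [exact: structure_constants_of_poisson lin | exact: lin].
- move=> br lam brP _ lin; split=> //.
  exact: (@linear_comul_compatible _ _ _ (poisson_biderivation brP) lam).
- move=> k2 lam lamP.
  exists (biderivation_of (fun i j => \sum_(l < d) lam i j l *: 'X_l)).
  split=> [||br' br'P lin' f g].
  + exact: poisson_of_structure_constants.
  + by move=> i j; exact: biderivation_ofX.
  apply: biderivation_ext => [||i j].
  + exact: poisson_biderivation.
  + exact: biderivation_ofP.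
  + by rewrite biderivation_ofX lin'.
Qed.
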